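(* Let $X_n$ be the unitary Cayley graph of order $n$. Then the adjacency matrix of the line graph $L(X_n)$ has exactly four distinct eigenvalues if and only if either $n=2p$ or $n=p^{\alpha}$, for some prime $p\geq 3$ and some integer $\alpha\geq 2$.
   Context: The unitary Cayley graph $X_n$ is the graph with vertex set $\mathbb{Z}_n=\{0,1,\ldots,n-1\}$ in which $i$ and $j$ are adjacent if and only if $\gcd(i-j,n)=1$. The line graph $L(G)$ of a graph $G$ has the edges of $G$ as vertices, two being adjacent if the corresponding edges share a vertex. *)

(* Defs.v *)
From HB Require Import structures.
From mathcomp Require Export all_boot all_order all_algebra.

Set Implicit Arguments.
Unset Strict Implicit.
Unset Printing Implicit Defensive.

Import Order.TTheory GRing.Theory Num.Theory.

(* A graph is an adjacency relation [g : rel T] on a finite vertex type. *)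

(* For n > 1 this relation is irreflexive, as gcd(0, n) = n.  For n = 1 it
   relates the unique vertex to itself; this loop is discarded by [edge_set],
   so that X_1 has no edge. *)
Definition unitary_cayley (n : nat) : rel 'I_n :=
  fun i j => gcdz (i%:Z - j%:Z)%R n%:Z == 1%R.
Arguments unitary_cayley n : clear implicits.

Definition edge_set (T : finType) (g : rel T) : {set {set T}} :=
  [set e : {set T} |
    [exists x, exists y, [&& x != y, g x y & e == [set x; y]]]].

Definition edge (T : finType) (g : rel T) : finType :=
  {e : {set T} | e \in edge_set g}.

Definition line_graph (T : finType) (g : rel T) : rel (edge g) :=
  fun e f => (e != f) && (val e :&: val f != set0).
Arguments line_graph {T} g.

(* Rows and columns follow the order of [enum T]. *)
Definition adjacency_matrix (F : fieldType) (T : finType) (g : rel T) :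
    'M[F]_#|T| :=
  \matrix_(i, j) ((g (enum_val i) (enum_val j))%:R)%R.

Definition num_distinct_eigenvalues (F : fieldType) (m : nat) (A : 'M[F]_m)
    (k : nat) : Prop :=
  exists s : seq F, [/\ uniq s, size s = k & s =i eigenvalue A].

(* Main.v *)
Require Import Defs.
From mathcomp Require Import all_boot all_order all_algebra.
From mathcomp Require Import zify ring lra.

(* For an r-regular graph G with incidence matrix B, both B B^T = A(G) + r and
   B^T B = A(L(G)) + 2, so the spectrum of L(G) is obtained by shifting the
   eigenvalues a <> -r of G to a + r - 2 and adding -2 as soon as B has a kernel
   on edges (which holds if r > 2, or if r > 1 and -r is an eigenvalue of G).
   By the Chinese remainder theorem X_(mn) is the tensor product of X_m and X_n
   for coprime m and n, and X_(p^(e+1)) is the tensor product of K_p with the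
   all-ones relation on p^e points.  Divided by phi(n), the eigenvalues of X_n
   include 1, -1/(p-1) for p | n, 1/((p-1)(q-1)) for distinct p, q | n, and 0 if
   n is not squarefree; together with -1 (the eigenvalue -2 of the line graph)
   these are at least 5 values unless n is a prime power or twice an odd
   prime. *)

Set Implicit Arguments.
Unset Strict Implicit.
Unset Printing Implicit Defensive.

Import Order.TTheory GRing.Theory Num.Theory.
Local Open Scope ring_scope.

(** * Spectrum of a line graph *)

(** Vertex functions replace row vectors, so that no enumeration of [T] enters the arguments. Here
    the matrix acts on columns whereas [eigenvalue] uses rows; symmetry of the graph reconciles the
    two. *)
Definition graph_eigenvalue (F : fieldType) (T : finType) (g : rel T) (a : F) :=
  exists2 f : T -> F,
    (exists x, f x != 0) & forall x, \sum_(y | g x y) f y = a * f x.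

Lemma eigenvalue_adjacencyP (F : fieldType) (T : finType) (g : rel T) (a : F) :
  symmetric g ->
  eigenvalue (adjacency_matrix F g) a <-> graph_eigenvalue g a.
Proof.
move=> gC; split.
- move=> /eigenvalueP[v vA v_neq0].
  exists (fun x => v 0 (enum_rank x)).
    have /rV0Pn[i vi] := v_neq0.
    by exists (enum_val i); rewrite enum_valK.
  move=> x; have := congr1 (fun w : 'rV_ _ => w 0 (enum_rank x)) vA.
  rewrite !mxE => <-; rewrite (reindex (@enum_val T T)) /=; last first.
    by apply: onW_bij; exact: enum_val_bij.
  rewrite big_mkcond /=; apply: eq_bigr => i _.
  by rewrite mxE enum_valK enum_rankK gC; case: (g _ _); rewrite ?mulr1 ?mulr0.
- move=> [f [x fx] fA]; apply/eigenvalueP.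
  exists (\row_i f (enum_val i)); last first.
    apply/rV0Pn; exists (enum_rank x).
    by rewrite mxE enum_rankK.
  apply/rowP => j; rewrite !mxE -fA (reindex (@enum_val T T)) /=; last first.
    by apply: onW_bij; exact: enum_val_bij.
  rewrite [RHS]big_mkcond /=; apply: eq_bigr => i _.
  by rewrite !mxE gC; case: (g _ _); rewrite ?mulr1 ?mulr0.
Qed.

(** In both cases the rank of [M] is below [#|S|]: there are too few columns, or [f] is a linear
    relation between them. It will be applied with edges for [S] and vertices for [T]. *)
Lemma left_kernel_neq0 (F : fieldType) (S T : finType) (M : S -> T -> F) :
  (#|T| < #|S|)%N \/
  (#|T| <= #|S|)%N /\
    (exists2 f : T -> F,
      (exists t, f t != 0) & forall s, \sum_t M s t * f t = 0) ->
  exists2 h : S -> F, (exists s, h s != 0) & forall t, \sum_s h s * M s t = 0.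
Proof.
pose A : 'M[F]_(#|S|, #|T|) := \matrix_(i, j) M (enum_val i) (enum_val j).
move=> dimST.
have rankA : (\rank A < #|S|)%N.
  case: dimST => [|[leTS [f [t ft] Mf]]]; first exact/leq_ltn_trans/rank_leq_col.
  apply: leq_trans leTS; rewrite ltn_neqAle rank_leq_col andbT.
  rewrite -mxrank_tr -/(row_free A^T).
  apply/negP => /row_freeP[B AB].
  pose v := \row_j f (enum_val j) : 'rV[F]_#|T|.
  have vA : v *m A^T = 0.
    apply/rowP => i; have := Mf (enum_val i).
    rewrite (reindex (@enum_val T T)) /=; last first.
      by apply: onW_bij; exact: enum_val_bij.
    move=> Mf0; rewrite !mxE -[RHS]Mf0.
    by apply: eq_bigr => j _; rewrite !mxE mulrC.
  have : v = 0 by rewrite -[v]mulmx1 -AB mulmxA vA mul0mx.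
  move/rowP/(_ (enum_rank t)); rewrite !mxE enum_rankK => ft0.
  by rewrite ft0 eqxx in ft.
have : kermx A != 0 by rewrite kermx_eq0 /row_free neq_ltn rankA.
move=> /matrix0Pn[i [j kij]].
exists (fun s => kermx A i (enum_rank s)).
  by exists (enum_val j); rewrite enum_valK.
move=> t; have := congr1 (fun w : 'M_(_, _) => w i (enum_rank t)) (mulmx_ker A).
rewrite !mxE => kA0; rewrite -[RHS]kA0 (reindex (@enum_val S S)) /=.
  by apply: eq_bigr => k _; rewrite !mxE enum_valK enum_rankK.
by apply: onW_bij; exact: enum_val_bij.
Qed.

Section LineGraph.

Variables (F : fieldType) (T : finType) (g : rel T) (r : nat).
Hypotheses (gC : symmetric g) (gI : irreflexive g).
Hypothesis g_regular : forall x, #|[pred y | g x y]| = r.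

Let E := edge g.

Lemma edgeP (e : E) : exists x y, [/\ x != y, g x y & val e = [set x; y]].
Proof.
case: e => e /=; rewrite inE => /existsP[x /existsP[y /and3P[xy gxy /eqP->]]].
by exists x, y.
Qed.

Lemma card_edge_vertices (e : E) : #|val e| = 2.
Proof. by have [x [y [xy _ ->]]] := edgeP e; rewrite cards2 xy. Qed.

(** These are the entries of B^T B: distinct sets of two elements share at most one point. *)
Lemma card_edgeI (e f : E) :
  #|val e :&: val f| = (2 * (e == f) + line_graph g e f)%N.
Proof.
rewrite /line_graph; have [<-|ef] := eqVneq e f.
  by rewrite setIid card_edge_vertices.
rewrite muln0 add0n /= -card_gt0.
have : (#|val e :&: val f| < 2)%N; last by case: #|_| => [|[|]].
rewrite ltnNge; apply: contra ef => I2.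
apply/eqP/val_inj/eqP; rewrite eqEcard !card_edge_vertices leqnn andbT.
have /eqP <- : val e :&: val f == val e.
  by rewrite eqEcard subsetIl card_edge_vertices.
exact: subsetIr.
Qed.

(** The off-diagonal entries of B B^T: only the set [[set x; y]] can be such an edge. *)
Lemma card_edges_through2 (x y : T) :
  x != y -> #|[pred e : E | (x \in val e) && (y \in val e)]| = g x y.
Proof.
move=> xy; have eE (e : E) : x \in val e -> y \in val e -> val e = [set x; y].
  move=> xe ye; apply/eqP; rewrite eq_sym eqEcard card_edge_vertices cards2 xy.
  by rewrite andbT; apply/subsetP => z /set2P[] ->.
case gxy : (g x y).
  have xyE : [set x; y] \in edge_set g.
    rewrite inE; apply/existsP; exists x; apply/existsP; exists y.
    by rewrite xy gxy /=.
  transitivity #|pred1 (exist _ [set x; y] xyE : E)|; last by rewrite card1.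
  apply: eq_card => e.
  rewrite !inE; apply/andP/eqP => [[xe ye]|->]; last by rewrite /= !inE !eqxx orbT.
  by apply/val_inj; rewrite (eE e).
apply: eq_card0 => e; rewrite !inE; apply/negP => /andP[xe ye].
have [u [v [uv guv e_uv]]] := edgeP e.
move: xe ye xy gxy; rewrite e_uv !inE.
move=> /orP[]/eqP-> /orP[]/eqP ->; rewrite ?eqxx // => _; first by rewrite guv.
by rewrite gC guv.
Qed.

Lemma card_edges_through (x : T) : #|[pred e : E | x \in val e]| = r.
Proof.
rewrite -(g_regular x) -!sum1_card.
(* Each edge through [x] has exactly one other endpoint [y]; exchanging the sums reduces the count
   to edges through two given points. *)
transitivity (\sum_(e : E | x \in val e) \sum_(y in val e :\ x) 1)%N.
  apply: eq_bigr => e; rewrite inE => xe; rewrite sum1_card.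
  by have := cardsD1 x (val e); rewrite card_edge_vertices xe => -[].
rewrite (exchange_big_dep (fun y => y != x)) /=; last first.
  by move=> e y _; rewrite !inE => /andP[].
rewrite [RHS]big_mkcond [RHS](bigD1 x) //= inE gI add0n.
apply: eq_bigr => y yx; rewrite eq_sym in yx.
transitivity (nat_of_bool (g x y)); last by rewrite inE; case: (g x y).
rewrite -(card_edges_through2 yx) -sum1_card.
by apply: eq_bigl => e; rewrite !inE eq_sym yx.
Qed.

Lemma double_card_edge : (2 * #|E| = #|T| * r)%N.
Proof.
transitivity (\sum_(e : E) \sum_(x in val e) 1)%N.
  under eq_bigr => e _ do rewrite sum1_card card_edge_vertices.
  by rewrite sum_nat_const mulnC.
rewrite (exchange_big_dep predT) //= -sum_nat_const; apply: eq_bigr => x _.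
by rewrite -(card_edges_through x) -sum1_card; apply: eq_bigl => e; rewrite inE.
Qed.

(** The identity B B^T = A(G) + r, applied to [f]. *)
Lemma incidence_vertex (f : T -> F) (x : T) :
  \sum_(e : E | x \in val e) \sum_(y in val e) f y
  = \sum_(y | g x y) f y + r%:R * f x.
Proof.
rewrite (exchange_big_dep predT) //= [X in _ = X + _]big_mkcond.
rewrite (bigD1 x) //= [X in _ = X + _](bigD1 x) //= gI add0r addrC.
congr (_ + _).
  apply: eq_bigr => y yx; rewrite eq_sym in yx.
  rewrite sumr_const (card_edges_through2 yx).
  by case: (g x y).
rewrite sumr_const mulr_natl -(card_edges_through x); congr (_ *+ _).
by apply: eq_card => e; rewrite unfold_in andbb inE.
Qed.

(** The identity B^T B = A(L(G)) + 2, applied to [h]. *)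
Lemma incidence_edge (h : E -> F) (e : E) :
  \sum_(x in val e) \sum_(f : E | x \in val f) h f
  = \sum_(f | line_graph g e f) h f + 2 * h e.
Proof.
rewrite (exchange_big_dep predT) //= [X in _ = X + _]big_mkcond.
rewrite (eq_bigr (fun f => h f *+ (2 * (e == f)) + h f *+ line_graph g e f)).
  rewrite big_split /= addrC; congr (_ + _).
    by apply: eq_bigr => f _; case: line_graph.
  rewrite (bigD1 e) //= big1 ?addr0 ?eqxx ?mulr_natl // => f.
  by rewrite eq_sym => /negPf ->.
move=> f _; rewrite sumr_const -mulrnDr -card_edgeI; congr (_ *+ _).
by apply: eq_card => x; rewrite !inE.
Qed.

(** If B h is nonzero, it is an eigenfunction of B B^T for [a + 2]; if it vanishes, then B^T B h = 0
    forces [a + 2 = 0]. *)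
Lemma line_graph_eigenvalue_inv (a : F) :
  graph_eigenvalue (line_graph g) a ->
  a = -2 \/ graph_eigenvalue g (a + 2 - r%:R).
Proof.
move=> [h [e he] Ah]; pose Bh x := \sum_(f : E | x \in val f) h f.
have BBh (f : E) : \sum_(x in val f) Bh x = (a + 2) * h f.
  by rewrite incidence_edge Ah [RHS]mulrDl.
have [/existsP[x Bhx]|/existsPn Bh0] := boolP [exists x, Bh x != 0].
  right; exists Bh; first by exists x.
  move=> y; apply: (addIr (r%:R * Bh y)); rewrite -incidence_vertex.
  by under eq_bigr => f _ do rewrite BBh; rewrite -mulr_sumr -/(Bh y); ring.
left; have := BBh e; rewrite big1; last first.
  by move=> x _; apply/eqP/negPn; exact: Bh0.
by move/esym/eqP; rewrite mulf_eq0 (negPf he) orbF addr_eq0 => /eqP ->.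
Qed.

(** The eigenfunction is B^T f, which is nonzero because B B^T f = (a + r) f is. *)
Lemma line_graph_eigenvalue (a : F) :
  graph_eigenvalue g a -> a != - r%:R ->
  graph_eigenvalue (line_graph g) (a + r%:R - 2).
Proof.
move=> [f [x fx] Af] ar; pose Bf (e : E) := \sum_(y in val e) f y.
have BBf y : \sum_(e : E | y \in val e) Bf e = (a + r%:R) * f y.
  by rewrite incidence_vertex Af [RHS]mulrDl.
exists Bf.
  apply/existsP; apply: contraTT fx => /existsPn Bf0; apply/negPn.
  have := BBf x; rewrite big1; last by move=> e _; apply/eqP/negPn; exact: Bf0.
  by move/esym/eqP; rewrite mulf_eq0 addr_eq0 (negPf ar).
move=> e; apply: (addIr (2 * Bf e)); rewrite -incidence_edge.
by under eq_bigr => y _ do rewrite BBf; rewrite -mulr_sumr -/(Bf e); ring.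
Qed.

(** A nonzero [h] with B h = 0 is needed. By double counting there are more edges than vertices if
    [r > 2], and at least as many if [r > 1]; in the latter case the eigenvalue [- r] gives the
    missing dependency. *)
Lemma line_graph_eigenvalueN2 :
  (2 < r)%N /\ (0 < #|T|)%N \/ (1 < r)%N /\ graph_eigenvalue g (- r%:R : F) ->
  graph_eigenvalue (line_graph g) (-2 : F).
Proof.
move=> H.
suff [h h0 Bh] : exists2 h : E -> F, (exists e, h e != 0) &
    forall x, \sum_(e : E | x \in val e) h e = 0.
  exists h => // e; apply: (addIr (2 * h e)); rewrite -incidence_edge big1 //.
  by ring.
pose M (e : E) (x : T) : F := (x \in val e)%:R.
suff [h h0 Bh] : exists2 h : E -> F, (exists e, h e != 0) &
    forall x, \sum_e h e * M e x = 0.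
  exists h => // x; rewrite -[RHS](Bh x) [LHS]big_mkcond; apply: eq_bigr => e _.
  by rewrite /M; case: (x \in _); rewrite ?mulr1 ?mulr0.
have := double_card_edge; case: H => [[r2 T0]|[r1 [f f0 Af]]] cE.
  by apply: left_kernel_neq0; left; nia.
have leTE : (#|T| <= #|E|)%N by nia.
pose Bf (e : E) := \sum_(y in val e) f y.
have BfE e : \sum_x M e x * f x = Bf e.
  rewrite /Bf [RHS]big_mkcond; apply: eq_bigr => x _.
  by rewrite /M; case: (x \in _); rewrite ?mul1r ?mul0r.
(* Here B B^T f = 0. Over a general field B^T f may still be nonzero, and then it is the kernel
   element; otherwise [f] makes the rank drop. *)
have [/existsP Bf1|/existsPn Bf0] := boolP [exists e, Bf e != 0].
  exists Bf => // x; transitivity (\sum_(e : E | x \in val e) Bf e).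
    rewrite [RHS]big_mkcond; apply: eq_bigr => e _.
    by rewrite /M; case: (x \in _); rewrite ?mulr1 ?mulr0.
  by rewrite incidence_vertex Af; ring.
apply: left_kernel_neq0; right; split => //; exists f => // e.
by rewrite BfE; apply/eqP/negPn; exact: Bf0.
Qed.

End LineGraph.

(** * Tensor products and unitary Cayley graphs *)

Section GraphOperations.

Variable F : fieldType.

Lemma graph_eigenvalue_iso (T T' : finType) (g : rel T) (g' : rel T')
    (h : T -> T') (a : F) :
  bijective h -> (forall x y, g' (h x) (h y) = g x y) ->
  graph_eigenvalue g a <-> graph_eigenvalue g' a.
Proof.
move=> [k hK kH] gh; split=> -[f [x fx] Af].
  exists (f \o k); first by exists (h x); rewrite /= hK.
  move=> y; rewrite /= -Af (reindex h) /=; last by exists k => z _.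
  by apply: eq_big => [z|z _]; rewrite ?hK // -gh kH.
exists (f \o h); first by exists (k x); rewrite /= kH.
move=> y; rewrite /= -Af [RHS](reindex h) /=; last by exists k => z _.
by apply: eq_bigl => z; rewrite gh.
Qed.

Lemma graph_eigenvalue_regular (T : finType) (g : rel T) (r : nat) (x : T) :
  (forall x, #|[pred y | g x y]| = r) -> graph_eigenvalue g (r%:R : F).
Proof.
move=> g_reg; exists (fun=> 1); first by exists x; exact: oner_neq0.
by move=> y; rewrite sumr_const mulr1 -(g_reg y).
Qed.

Definition tensor_graph (T1 T2 : finType) (g1 : rel T1) (g2 : rel T2) :
    rel (T1 * T2) :=
  fun x y => g1 x.1 y.1 && g2 x.2 y.2.

Lemma graph_eigenvalue_tensor (T1 T2 : finType) (g1 : rel T1) (g2 : rel T2)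
    (a b : F) :
  graph_eigenvalue g1 a -> graph_eigenvalue g2 b ->
  graph_eigenvalue (tensor_graph g1 g2) (a * b).
Proof.
move=> [f1 [x fx] A1] [f2 [y fy] A2]; exists (fun z => f1 z.1 * f2 z.2).
  by exists (x, y); rewrite mulf_neq0.
move=> [u v] /=; rewrite mulrACA -A1 -A2 big_distrlr /= pair_big /=.
by apply: eq_bigl.
Qed.

Lemma sum_delta (T : finType) (w : T) : \sum_y (y == w)%:R = 1 :> F.
Proof. by rewrite (bigD1 w) //= eqxx big1 ?addr0 // => y /negPf ->. Qed.

Lemma complete_graph_eigenvalueN1 (T : finType) :
  (1 < #|T|)%N -> graph_eigenvalue (fun x y : T => x != y) (-1 : F).
Proof.
move=> T_gt1; have /card_gt1P[u [v [_ _ uv]]] := T_gt1.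
exists (fun x => (x == u)%:R - (x == v)%:R).
  by exists u; rewrite eqxx (negPf uv) subr0 oner_neq0.
(* Adding the value at [x] completes the sum over neighbours to the sum over all vertices, which is
   0. *)
move=> x; apply: (addrI ((x == u)%:R - (x == v)%:R)).
transitivity (\sum_y ((y == u)%:R - (y == v)%:R) : F).
  by rewrite [RHS](bigD1 x) //=; congr (_ + _); apply: eq_bigl => y; rewrite eq_sym.
by rewrite sumrB !sum_delta; ring.
Qed.

(** The total [S] of an eigenfunction satisfies [S = (a + 1) * f y] for every [y]. Either [S = 0]
    and [a = -1], or summing over [y] gives [a + 1 = #|T|]. *)
Lemma complete_graph_eigenvalue_inv (T : finType) (a : F) :
  graph_eigenvalue (fun x y : T => x != y) a ->
  a = #|T|%:R - 1 \/ a = -1.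
Proof.
move=> [f [x fx] Af]; pose S := \sum_y f y.
have SE y : S = (a + 1) * f y.
  rewrite /S (bigD1 y) //= mulrDl mul1r -Af addrC; congr (_ + _).
  by apply: eq_bigl => z; rewrite eq_sym.
have [S0|S_neq0] := eqVneq S 0.
  right; have := SE x; rewrite S0 => /esym/eqP.
  by rewrite mulf_eq0 (negPf fx) orbF addr_eq0 => /eqP.
left; suff : a + 1 = #|T|%:R by move=> <-; rewrite addrK.
apply: (mulIf S_neq0); rewrite {1}/S mulr_sumr.
by under eq_bigr => y _ do rewrite -SE; rewrite sumr_const mulr_natl.
Qed.

Lemma full_graph_eigenvalue0 (T : finType) :
  (1 < #|T|)%N -> graph_eigenvalue (fun _ _ : T => true) (0 : F).
Proof.
move=> T_gt1; have /card_gt1P[u [v [_ _ uv]]] := T_gt1.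
exists (fun x => (x == u)%:R - (x == v)%:R).
  by exists u; rewrite eqxx (negPf uv) subr0 oner_neq0.
by move=> x; rewrite sumrB !sum_delta; ring.
Qed.

(** Summing [f] over the second coordinate gives either an eigenfunction of [g] for [a / #|T2|], or
    0, and then [a * f = 0]. *)
Lemma tensor_full_eigenvalue_inv (T1 T2 : finType) (g : rel T1) (a : F) :
  #|T2|%:R != 0 :> F ->
  graph_eigenvalue (tensor_graph g (fun _ _ : T2 => true)) a ->
  a = 0 \/ exists2 b, graph_eigenvalue g b & a = b * #|T2|%:R.
Proof.
move=> s_neq0 [f [[u v] fuv] Af]; pose f1 x := \sum_y f (x, y).
have f1E x y : \sum_(z | g x z) f1 z = a * f (x, y).
  rewrite -Af /f1 pair_big_dep /=.
  by apply: eq_big => [[z1 z2]|[z1 z2] _] //=; rewrite /tensor_graph /= andbT.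
have [/existsP[x f1x]|/existsPn f10] := boolP [exists x, f1 x != 0].
  right; exists (a / #|T2|%:R); last by rewrite divfK.
  exists f1; first by exists x.
  move=> y; apply: (mulIf s_neq0).
  rewrite mulrAC divfK // /f1 mulr_sumr -(eq_bigr _ (fun z _ => f1E y z)).
  by rewrite sumr_const mulr_natr.
left; have := f1E u v; rewrite big1 => [/esym/eqP|x _].
  by rewrite mulf_eq0 (negPf fuv) orbF => /eqP.
by apply/eqP/negPn; exact: f10.
Qed.

(** The adjacency of [g] exchanges the two layers [f0] and [f1] up to the factor [a], so their sum
    and difference belong to [a] and [- a]. Since 2 is invertible, both vanish only if [f] does. *)
Lemma tensor_K2_eigenvalue_inv (T : finType) (g : rel T) (a : F) :
  2 != 0 :> F ->
  graph_eigenvalue (tensor_graph (fun x y : 'I_2 => x != y) g) a ->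
  graph_eigenvalue g a \/ graph_eigenvalue g (- a).
Proof.
move=> two_neq0 [f [[u v] fuv] Af].
pose f0 x := f (ord0, x); pose f1 x := f (ord_max, x).
have sumE (i : 'I_2) x :
    \sum_(z | tensor_graph (fun x y : 'I_2 => x != y) g (i, x) z) f z
    = \sum_(j | i != j) \sum_(y | g x y) f (j, y).
  by rewrite pair_big /=; apply: eq_big => [[]|[]].
have A0 x : \sum_(y | g x y) f1 y = a * f0 x.
  by rewrite -Af sumE [RHS]big_mkcond !big_ord_recl big_ord0 /= addr0 add0r;
    apply: eq_bigr => y _; congr (f (_, _)); apply: val_inj.
have A1 x : \sum_(y | g x y) f0 y = a * f1 x.
  by rewrite -Af sumE [RHS]big_mkcond !big_ord_recl big_ord0 /= !addr0.
have [/existsP[x fx]|/existsPn fD] := boolP [exists x, f0 x + f1 x != 0].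
  left; exists (fun x => f0 x + f1 x); first by exists x.
  by move=> y; rewrite big_split /= A0 A1; ring.
have [/existsP[x fx]|/existsPn fB] := boolP [exists x, f0 x - f1 x != 0].
  right; exists (fun x => f0 x - f1 x); first by exists x.
  by move=> y; rewrite sumrB /= A0 A1; ring.
have fD0 x : f0 x + f1 x = 0 by apply/eqP/negPn; exact: fD.
have fB0 x : f0 x - f1 x = 0 by apply/eqP/negPn; exact: fB.
have f0v : f0 v = 0.
  apply: (mulfI two_neq0); rewrite mulr0.
  by transitivity ((f0 v + f1 v) + (f0 v - f1 v)); [ring | rewrite fD0 fB0 addr0].
have f1v : f1 v = 0 by have := fD0 v; rewrite f0v add0r.
case/negP: fuv; apply/eqP.
have : u = ord0 \/ u = ord_max.
  by case: (u) => -[|[|//]] ?; [left | right]; apply: val_inj.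
by case=> ->; [exact: f0v | exact: f1v].
Qed.

End GraphOperations.

(** * Unitary Cayley graphs: regularity and tensor decompositions *)

Lemma unitary_cayleyE n (i j : 'I_n) :
  unitary_cayley n i j = coprime `|i%:Z - j%:Z|%N n.
Proof. by []. Qed.

Lemma unitary_cayley_sym n : symmetric (unitary_cayley n).
Proof. by move=> i j; rewrite !unitary_cayleyE distnC. Qed.

Lemma unitary_cayley_irr n : (1 < n)%N -> irreflexive (unitary_cayley n).
Proof.
by move=> n_gt1 i; rewrite unitary_cayleyE subrr /coprime gcd0n gtn_eqF.
Qed.

Lemma coprime_dist_mod (i j n : nat) :
  coprime `|(i %% n)%:Z - (j %% n)%:Z|%N n = coprime `|i%:Z - j%:Z|%N n.
Proof.
suff : gcdz ((i %% n)%:Z - (j %% n)%:Z) n%:Z = gcdz (i%:Z - j%:Z) n%:Z.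
  by rewrite /gcdz /coprime => -[->].
by rewrite -gcdz_modl -!modz_nat modzDml -modzDmr modzNm modzDmr gcdz_modl.
Qed.

Lemma unitary_cayley_regular n (x : 'I_n) :
  #|[pred y | unitary_cayley n x y]| = totient n.
Proof.
case: n x => [[] //|n] x; rewrite totient_count_coprime big_mkord.
(* Translation by [x] in Z_n carries the residues coprime to n onto the neighbours of [x]. *)
rewrite -sum1_card (reindex_inj (addrI x)) /= big_mkcond.
apply: eq_bigr => y _; rewrite inE unitary_cayleyE.
have -> : coprime `|x%:Z - (x + y)%R%:Z|%N n.+1 = coprime n.+1 y.
  rewrite -(modn_small (ltn_ord x)) /= coprime_dist_mod.
  by rewrite PoszD opprD addNKr abszN /= coprime_sym.
by case: coprime.
Qed.

Lemma unitary_cayley_prime_powE p e (x y : 'I_(p ^ e.+1)) :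
  prime p -> unitary_cayley (p ^ e.+1) x y = (x %% p != y %% p)%N.
Proof.
move=> p_pr; rewrite unitary_cayleyE coprime_sym coprime_pexpl // prime_coprime //.
by rewrite -[(p %| _)%N]/((p%:Z %| x%:Z - y%:Z)%Z) -eqz_mod_dvd !modz_nat eqz_nat.
Qed.

(** Vertices are split into remainder and quotient by [p]. Adjacency depends on the remainders only,
    hence the all-ones relation on quotients. *)
Lemma graph_eigenvalue_prime_pow (F : fieldType) p e (a : F) :
  prime p ->
  graph_eigenvalue (unitary_cayley (p ^ e.+1)) a <->
  graph_eigenvalue
    (tensor_graph (fun x y : 'I_p => x != y) (fun _ _ : 'I_(p ^ e) => true)) a.
Proof.
move=> p_pr; have p_gt0 := prime_gt0 p_pr.
have ltd (x : 'I_(p ^ e.+1)) : (x %/ p < p ^ e)%N.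
  by rewrite ltn_divLR // -expnSr.
pose h (x : 'I_(p ^ e.+1)) := (Ordinal (ltn_pmod x p_gt0), Ordinal (ltd x)).
apply: (graph_eigenvalue_iso (h := h)); last first.
  by move=> x y; rewrite unitary_cayley_prime_powE // /tensor_graph andbT.
apply: inj_card_bij; last by rewrite card_prod !card_ord expnS.
move=> x y [xy1 xy2]; apply: val_inj.
by rewrite /= (divn_eq x p) (divn_eq y p) xy1 xy2.
Qed.

Lemma graph_eigenvalue_coprime (F : fieldType) m n (a : F) :
  (0 < m)%N -> (0 < n)%N -> coprime m n ->
  graph_eigenvalue (unitary_cayley (m * n)) a <->
  graph_eigenvalue (tensor_graph (unitary_cayley m) (unitary_cayley n)) a.
Proof.
move=> m_gt0 n_gt0 mn.
pose h (x : 'I_(m * n)) :=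
  (Ordinal (ltn_pmod x m_gt0), Ordinal (ltn_pmod x n_gt0)).
apply: (graph_eigenvalue_iso (h := h)); last first.
  move=> x y; rewrite /tensor_graph !unitary_cayleyE /= !coprime_dist_mod.
  by rewrite coprimeMr.
apply: inj_card_bij; last by rewrite card_prod !card_ord.
move=> x y [xy1 xy2]; apply: val_inj => /=.
have /eqP : x == y %[mod m * n] by rewrite chinese_remainder // xy1 xy2 !eqxx.
by rewrite !modn_small.
Qed.

(** * Counting the eigenvalues *)

Section UnitaryCayley.

Variable C : numFieldType.

(* The eigenvalues of X_n divided by the degree phi(n); this normalization makes
   them multiplicative over coprime factors of n. *)
Definition cayley_ratio (n : nat) (c : rat) :=
  graph_eigenvalue (unitary_cayley n) (ratr c * (totient n)%:R : C).

Lemma cayley_ratioM m n c d :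
  (0 < m)%N -> (0 < n)%N -> coprime m n ->
  cayley_ratio m c -> cayley_ratio n d -> cayley_ratio (m * n) (c * d).
Proof.
move=> m_gt0 n_gt0 mn mc nd; apply/graph_eigenvalue_coprime => //.
have := graph_eigenvalue_tensor mc nd.
by rewrite totient_coprime // natrM rmorphM /= mulrACA.
Qed.

Lemma cayley_ratio1 n : (0 < n)%N -> cayley_ratio n 1.
Proof.
move=> n_gt0; rewrite /cayley_ratio rmorph1 mul1r.
exact: (graph_eigenvalue_regular _ (Ordinal n_gt0) (@unitary_cayley_regular n)).
Qed.

Lemma complete_graph_regular (T : finType) (x : T) :
  #|[pred y | x != y]| = #|T|.-1.
Proof. by rewrite -(cardC1 x); apply: eq_card => y; rewrite !inE eq_sym. Qed.

(** The eigenvalue -1 of K_p times the degree p^e of the all-ones relation, divided by phi(p^(e+1))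
    = (p-1)p^e. *)
Lemma cayley_ratio_prime_pow p e :
  prime p -> cayley_ratio (p ^ e.+1) (- p.-1%:R^-1).
Proof.
move=> p_pr; have p_gt1 := prime_gt1 p_pr.
have p1_neq0 : p.-1%:R != 0 :> C by rewrite pnatr_eq0; lia.
apply/graph_eigenvalue_prime_pow => //.
have -> : ratr (- p.-1%:R^-1) * (totient (p ^ e.+1))%:R
    = -1 * #|'I_(p ^ e)|%:R :> C.
  rewrite totient_pfactor //= card_ord natrM rmorphN fmorphV /= ratr_nat.
  by field.
have pe_gt0 : (0 < p ^ e)%N by rewrite expn_gt0 ltnW.
apply: graph_eigenvalue_tensor.
  by apply: complete_graph_eigenvalueN1; rewrite card_ord.
exact: (graph_eigenvalue_regular _ (Ordinal pe_gt0)).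
Qed.

(** With exponent at least 2 the all-ones factor has more than one point, so it has the eigenvalue
    0. *)
Lemma cayley_ratio_prime_pow0 p e : prime p -> cayley_ratio (p ^ e.+2) 0.
Proof.
move=> p_pr; have p_gt1 := prime_gt1 p_pr.
apply/graph_eigenvalue_prime_pow => //.
have -> : ratr 0 * (totient (p ^ e.+2))%:R = p.-1%:R * 0 :> C.
  by rewrite rmorph0 mul0r mulr0.
apply: graph_eigenvalue_tensor; last first.
  by apply: full_graph_eigenvalue0; rewrite card_ord -(expn0 p) ltn_exp2l.
apply: (graph_eigenvalue_regular _ (Ordinal (ltnW p_gt1))) => x.
by rewrite complete_graph_regular card_ord.
Qed.

Lemma prime_part p n : prime p -> (0 < n)%N -> (p %| n)%N ->
  exists e m, [/\ (0 < m)%N, coprime (p ^ e.+1) m & n = (p ^ e.+1 * m)%N].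
Proof.
move=> p_pr n_gt0 pn; have [m pm nE] := pfactor_coprime p_pr n_gt0.
have : (0 < logn p n)%N by rewrite logn_gt0 mem_primes p_pr n_gt0.
case: (logn p n) nE => // e nE _; exists e, m; split.
- by move: n_gt0; rewrite nE muln_gt0 => /andP[].
- by rewrite coprimeXl.
- by rewrite mulnC.
Qed.

Lemma cayley_ratio_prime p n :
  prime p -> (0 < n)%N -> (p %| n)%N -> cayley_ratio n (- p.-1%:R^-1).
Proof.
move=> p_pr n_gt0 pn; have [e [m [m_gt0 cop ->]]] := prime_part p_pr n_gt0 pn.
rewrite -[X in cayley_ratio _ X]mulr1; apply: cayley_ratioM => //.
- by rewrite expn_gt0 prime_gt0.
- exact: cayley_ratio_prime_pow.
- exact: cayley_ratio1.
Qed.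

Lemma cayley_ratio_square p n :
  prime p -> (0 < n)%N -> (p ^ 2 %| n)%N -> cayley_ratio n 0.
Proof.
move=> p_pr n_gt0 p2n.
have pn : (p %| n)%N by apply: dvdn_trans p2n; rewrite dvdn_exp.
have [[|e] [m [m_gt0 cop nE]]] := prime_part p_pr n_gt0 pn.
  (* If the exponent of [p] were 1, [p] would divide the coprime cofactor [m], forcing [p = 1]. *)
  case/negP: (prime_gt1 p_pr : (1 < p)%N).
  have : (p %| m)%N.
    by move: p2n; rewrite nE expnS expn1 dvdn_pmul2l // prime_gt0.
  by move/eqP: cop; rewrite expn1 => cop /gcdn_idPl; rewrite cop => <-.
rewrite nE -[X in cayley_ratio _ X](mulr1 0); apply: cayley_ratioM => //.
- by rewrite expn_gt0 prime_gt0.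
- exact: cayley_ratio_prime_pow0.
- exact: cayley_ratio1.
Qed.

(** The product of the negative ratios of the [p]-part and of its cofactor, which [q] still
    divides. *)
Lemma cayley_ratio_two_primes p q n :
  prime p -> prime q -> p != q -> (0 < n)%N -> (p %| n)%N -> (q %| n)%N ->
  cayley_ratio n (p.-1%:R^-1 * q.-1%:R^-1).
Proof.
move=> p_pr q_pr pq n_gt0 pn qn.
have [e [m [m_gt0 cop nE]]] := prime_part p_pr n_gt0 pn.
have qm : (q %| m)%N.
  move: qn; rewrite nE Gauss_dvdr // coprime_sym coprimeXl //.
  by rewrite prime_coprime // dvdn_prime2.
rewrite nE -mulrNN; apply: cayley_ratioM => //.
- by rewrite expn_gt0 prime_gt0.
- exact: cayley_ratio_prime_pow.
- exact: cayley_ratio_prime.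
Qed.

(** The shift a + r - 2 for a = c phi(n). The ratio -1 gives -2, so rational ratios label this
    eigenvalue of the line graph as well. *)
Definition line_value (n : nat) (c : rat) : C :=
  ratr c * (totient n)%:R + (totient n)%:R - 2.

Lemma line_value_inj n : (0 < n)%N -> injective (line_value n).
Proof.
move=> n_gt0 c d /addIr/addIr/mulIf cd; apply: (fmorph_inj (@ratr C)).
by apply: cd; rewrite pnatr_eq0 -lt0n totient_gt0.
Qed.

Lemma line_valueN1 n : line_value n (-1) = -2.
Proof. by rewrite /line_value rmorphN1; ring. Qed.

Definition line_cayley_ratio (n : nat) (c : rat) :=
  graph_eigenvalue (line_graph (unitary_cayley n)) (line_value n c).

Lemma line_cayley_ratioW n c :
  (1 < n)%N -> c != -1 -> cayley_ratio n c -> line_cayley_ratio n c.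
Proof.
move=> n_gt1 cN1 nc.
apply: (line_graph_eigenvalue (unitary_cayley_sym (n := n))
  (unitary_cayley_irr n_gt1) (@unitary_cayley_regular n) nc).
apply: contra cN1 => /eqP cE; apply/eqP/(@line_value_inj n (ltnW n_gt1)).
by rewrite line_valueN1 /line_value cE; ring.
Qed.

(** The second alternative serves n = 6, where phi(n) is only 2. *)
Lemma line_cayley_ratioN1 n :
  (1 < n)%N ->
  (2 < totient n)%N \/ (1 < totient n)%N /\ cayley_ratio n (-1) ->
  line_cayley_ratio n (-1).
Proof.
move=> n_gt1 H; rewrite /line_cayley_ratio line_valueN1.
apply: (line_graph_eigenvalueN2 (unitary_cayley_sym (n := n))
  (unitary_cayley_irr n_gt1) (@unitary_cayley_regular n)).
case: H => [r2|[r1]]; first by left; split=> //; rewrite card_ord ltnW.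
by rewrite /cayley_ratio rmorphN1 mulN1r; right.
Qed.

Lemma line_cayley_ratio_inv n a :
  (1 < n)%N -> graph_eigenvalue (line_graph (unitary_cayley n)) a ->
  a = line_value n (-1) \/
  exists2 b : C, graph_eigenvalue (unitary_cayley n) b
    & a = b + (totient n)%:R - 2.
Proof.
move=> n_gt1 /(line_graph_eigenvalue_inv (unitary_cayley_sym (n := n))
  (unitary_cayley_irr n_gt1) (@unitary_cayley_regular n))[->|nb].
  by left; rewrite line_valueN1.
by right; exists (a + 2 - (totient n)%:R) => //; ring.
Qed.

Lemma prime_pow_eigenvalue_inv p e (a : C) :
  prime p -> graph_eigenvalue (unitary_cayley (p ^ e.+1)) a ->
  exists2 c, a = ratr c * (totient (p ^ e.+1))%:R
    & c \in [:: 1; - p.-1%:R^-1; 0 : rat].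
Proof.
move=> p_pr /(graph_eigenvalue_prime_pow _ _ p_pr).
have p_gt1 := prime_gt1 p_pr.
have p1_neq0 : p.-1%:R != 0 :> C by rewrite pnatr_eq0; lia.
move=> /tensor_full_eigenvalue_inv[|->|[b /complete_graph_eigenvalue_inv bE ->]].
- by rewrite card_ord pnatr_eq0 -lt0n expn_gt0 prime_gt0.
- by exists 0; rewrite ?inE ?eqxx ?orbT // rmorph0 mul0r.
rewrite totient_pfactor //= !card_ord natrM in bE *; case: bE => ->.
  exists 1; rewrite ?inE ?eqxx // rmorph1 mul1r -{1}(prednK (ltnW p_gt1)).
  by rewrite -natr1 addrK.
exists (- p.-1%:R^-1); rewrite ?inE ?eqxx ?orbT //.
by rewrite rmorphN fmorphV /= ratr_nat; field.
Qed.

(** X_p is the complete graph K_p, so the ratio 0, allowed in the list for prime powers, is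
    absent. *)
Lemma prime_eigenvalue_inv p (a : C) :
  prime p -> graph_eigenvalue (unitary_cayley p) a ->
  exists2 c, a = ratr c * (totient p)%:R
    & c \in [:: 1; - p.-1%:R^-1 : rat].
Proof.
move=> p_pr pa; have p_gt1 := prime_gt1 p_pr.
have p1_neq0 : p.-1%:R != 0 :> C by rewrite pnatr_eq0; lia.
have KpE (x y : 'I_p) : unitary_cayley p x y = (x != y).
  have := @unitary_cayley_prime_powE p 0; rewrite expn1 => -> //.
  by rewrite !modn_small.
have : graph_eigenvalue (fun x y : 'I_p => x != y) a.
  by apply/(graph_eigenvalue_iso a (h := id)); [exists id | exact: KpE | ].
rewrite totient_prime // => /complete_graph_eigenvalue_inv[]->.
  exists 1; rewrite ?inE ?eqxx // rmorph1 mul1r card_ord.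
  by rewrite -{1}(prednK (ltnW p_gt1)) -natr1 addrK.
exists (- p.-1%:R^-1); rewrite ?inE ?eqxx ?orbT //.
by rewrite rmorphN fmorphV /= ratr_nat; field.
Qed.

(** X_(2p) is the tensor product of K_2 and X_p, so the ratios are those of X_p and their
    opposites. *)
Lemma double_prime_eigenvalue_inv p (a : C) :
  prime p -> (2 < p)%N -> graph_eigenvalue (unitary_cayley (2 * p)) a ->
  exists2 c, a = ratr c * (totient (2 * p))%:R
    & c \in [:: 1; -1; p.-1%:R^-1; - p.-1%:R^-1 : rat].
Proof.
move=> p_pr p_gt2; have cop : coprime 2 p.
  by rewrite prime_coprime // dvdn_prime2 // ltn_eqF.
move=> /graph_eigenvalue_coprime-/(_ isT (prime_gt0 p_pr) cop) K2p.
have {}K2p : graph_eigenvalue (tensor_graph (fun x y : 'I_2 => x != y)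
    (unitary_cayley p)) a.
  apply/(graph_eigenvalue_iso a (h := id)); [by exists id | | exact: K2p].
  by move=> [x1 x2] [y1 y2]; rewrite /tensor_graph /=; congr (_ && _);
    case: x1 y1 => -[|[|//]] ? [[|[|//]] ?].
rewrite totient_coprime // mul1n.
have [] := tensor_K2_eigenvalue_inv _ K2p; first by rewrite pnatr_eq0.
  move=> /(prime_eigenvalue_inv p_pr)[c -> cE]; exists c => //.
  by move: cE; rewrite !inE => /orP[]->; rewrite ?orbT.
move=> /(prime_eigenvalue_inv p_pr)[c /(canRL opprK) -> cE]; exists (- c).
  by rewrite rmorphN mulNr.
by move: cE; rewrite !inE !eqr_opp !eqr_oppLR => /orP[]->; rewrite ?orbT.
Qed.

Lemma line_graph_sym (T : finType) (g : rel T) : symmetric (line_graph g).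
Proof. by move=> e f; rewrite /line_graph eq_sym setIC. Qed.

Local Notation line_matrix n :=
  (adjacency_matrix C (line_graph (unitary_cayley n))).

Lemma eigenvalue_line_matrixP n a :
  eigenvalue (line_matrix n) a <->
  graph_eigenvalue (line_graph (unitary_cayley n)) a.
Proof. exact/eigenvalue_adjacencyP/line_graph_sym. Qed.

(** Since [line_value n] is injective, distinctness of eigenvalues in [C] reduces to distinctness of
    rational ratios. *)
Lemma num_distinct_line_ge n k (cs : seq rat) :
  (0 < n)%N -> uniq cs -> {in cs, forall c, line_cayley_ratio n c} ->
  num_distinct_eigenvalues (line_matrix n) k -> (size cs <= k)%N.
Proof.
move=> n_gt0 cs_uniq cs_eig [s [s_uniq <- sE]].
rewrite -(size_map (line_value n)); apply: uniq_leq_size.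
  by rewrite map_inj_uniq //; exact: line_value_inj.
move=> _ /mapP[c /cs_eig nc ->]; rewrite sE; exact/eigenvalue_line_matrixP.
Qed.

Lemma num_distinct_line_le n k (cs : seq rat) :
  (forall a, graph_eigenvalue (line_graph (unitary_cayley n)) a ->
    a \in map (line_value n) cs) ->
  num_distinct_eigenvalues (line_matrix n) k -> (k <= size cs)%N.
Proof.
move=> cs_eig [s [s_uniq <- sE]]; rewrite -(size_map (line_value n)).
apply: uniq_leq_size => // a; rewrite sE => /eigenvalue_line_matrixP.
exact: cs_eig.
Qed.

Lemma num_distinct_line n (cs : seq rat) :
  (0 < n)%N -> uniq cs -> {in cs, forall c, line_cayley_ratio n c} ->
  (forall a, graph_eigenvalue (line_graph (unitary_cayley n)) a ->
    a \in map (line_value n) cs) ->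
  num_distinct_eigenvalues (line_matrix n) (size cs).
Proof.
move=> n_gt0 cs_uniq cs_eig cs_all; exists (map (line_value n) cs); split.
- by rewrite map_inj_uniq //; exact: line_value_inj.
- by rewrite size_map.
move=> a; apply/idP/idP => [/mapP[c /cs_eig nc ->]|/eigenvalue_line_matrixP].
  exact/eigenvalue_line_matrixP.
exact: cs_all.
Qed.

Lemma line_eigenvalue_mem n (cs : seq rat) :
  (1 < n)%N -> -1 \in cs ->
  (forall b : C, graph_eigenvalue (unitary_cayley n) b ->
    exists2 c, b = ratr c * (totient n)%:R & c \in cs) ->
  forall a, graph_eigenvalue (line_graph (unitary_cayley n)) a ->
    a \in map (line_value n) cs.
Proof.
move=> n_gt1 csN1 cs_all a /(line_cayley_ratio_inv n_gt1)[->|[b /cs_all[c -> cc] ->]].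
  exact: map_f.
by rewrite -/(line_value n c) map_f.
Qed.

End UnitaryCayley.

Lemma inv_nat_lt1 (a : nat) : (1 < a)%N -> 0 < (a%:R^-1 : rat) < 1.
Proof.
by move=> a_gt1; rewrite invr_gt0 invf_lt1 ?ltr0n ?ltr1n ?a_gt1 ltnW.
Qed.

Lemma dvdn_prime_totient p n : prime p -> (0 < n)%N -> (p %| n)%N ->
  (p.-1 <= totient n)%N.
Proof.
move=> p_pr n_gt0 pn; have [e [m [m_gt0 cop ->]]] := prime_part p_pr n_gt0 pn.
rewrite totient_coprime // totient_pfactor //= -mulnA leq_pmulr //.
by rewrite muln_gt0 expn_gt0 prime_gt0 // totient_gt0.
Qed.

(** * Eigenvalue counts according to the factorization of n *)

Section FourEigenvalues.

Variable C : numFieldType.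

Lemma line_cayley_ratio_odd_primes p q n :
  prime p -> prime q -> (2 < p)%N -> (2 < q)%N -> p != q -> (0 < n)%N ->
  (p %| n)%N -> (q %| n)%N ->
  {in [:: 1; -1; - p.-1%:R^-1; - q.-1%:R^-1; p.-1%:R^-1 * q.-1%:R^-1],
    forall c, line_cayley_ratio C n c}.
Proof.
move=> p_pr q_pr p_gt2 q_gt2 pq n_gt0 pn qn.
have n_gt1 : (1 < n)%N by have := dvdn_leq n_gt0 pn; lia.
have /andP[x0 x1] : 0 < (p.-1%:R^-1 : rat) < 1 by apply: inv_nat_lt1; lia.
have /andP[y0 y1] : 0 < (q.-1%:R^-1 : rat) < 1 by apply: inv_nat_lt1; lia.
(* The larger of two distinct odd primes exceeds 3, and phi(n) is at least that prime minus 1. *)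
have r_gt2 : (2 < totient n)%N.
  have := dvdn_prime_totient p_pr n_gt0 pn.
  have := dvdn_prime_totient q_pr n_gt0 qn.
  have p4 : p != 4 by apply: contraTneq p_pr => ->.
  have q4 : q != 4 by apply: contraTneq q_pr => ->.
  lia.
have r2 := cayley_ratio_two_primes C p_pr q_pr pq n_gt0 pn qn.
have rp := cayley_ratio_prime C p_pr n_gt0 pn.
have rq := cayley_ratio_prime C q_pr n_gt0 qn.
move=> c; rewrite !inE => /or4P[/eqP->|/eqP->|/eqP->|/orP[]/eqP->].
- by apply: line_cayley_ratioW => //; exact: cayley_ratio1.
- by apply: line_cayley_ratioN1 => //; left.
- by apply: line_cayley_ratioW => //; lra.
- by apply: line_cayley_ratioW => //; lra.
- by apply: line_cayley_ratioW => //; nra.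
Qed.

Lemma line_cayley_ratio_even p n :
  prime p -> (2 < p)%N -> (0 < n)%N -> (2 %| n)%N -> (p %| n)%N ->
  {in [:: 1; -1; p.-1%:R^-1; - p.-1%:R^-1],
    forall c, line_cayley_ratio C n c}.
Proof.
move=> p_pr p_gt2 n_gt0 n2 pn.
have n_gt1 : (1 < n)%N by have := dvdn_leq n_gt0 pn; lia.
have /andP[x0 x1] : 0 < (p.-1%:R^-1 : rat) < 1 by apply: inv_nat_lt1; lia.
have p2 : p != 2 by rewrite gtn_eqF.
have r2 := cayley_ratio_two_primes C p_pr (isT : prime 2) p2 n_gt0 pn n2.
have rp := cayley_ratio_prime C p_pr n_gt0 pn.
have rN1 := cayley_ratio_prime C (isT : prime 2) n_gt0 n2.
(* For the prime 2 the factor 1/(2-1) is 1, so -1 is itself a ratio and the pair [p], 2 yields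
   1/(p-1). *)
rewrite /= invr1 ?mulr1 in r2 rN1.
move=> c; rewrite !inE => /or4P[]/eqP->.
- by apply: line_cayley_ratioW => //; exact: cayley_ratio1.
- apply: line_cayley_ratioN1 => //; right; split => //.
  by have := dvdn_prime_totient p_pr n_gt0 pn; lia.
- by apply: line_cayley_ratioW => //; lra.
- by apply: line_cayley_ratioW => //; lra.
Qed.

Lemma num_distinct_line_prime_pow p e :
  prime p -> (2 < p)%N ->
  num_distinct_eigenvalues
    (adjacency_matrix C (line_graph (unitary_cayley (p ^ e.+2)))) 4.
Proof.
move=> p_pr p_gt2; set n := (p ^ e.+2)%N.
have n_gt0 : (0 < n)%N by rewrite expn_gt0 prime_gt0.
have pn : (p %| n)%N by rewrite /n expnS dvdn_mulr.
have n_gt1 : (1 < n)%N by have := dvdn_leq n_gt0 pn; lia.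
have /andP[x0 x1] : 0 < (p.-1%:R^-1 : rat) < 1 by apply: inv_nat_lt1; lia.
have r_gt2 : (2 < totient n)%N.
  rewrite totient_pfactor //= expnS; apply: (@leq_trans (2 * (3 * 1))) => //.
  by rewrite !leq_mul // ?expn_gt0 ?prime_gt0 //; lia.
apply: (@num_distinct_line C n [:: 1; -1; - p.-1%:R^-1; 0]) => //.
- by rewrite /= !inE !negb_or !andbT; apply/and3P; split; rewrite ?andbT; lra.
- move=> c; rewrite !inE => /or4P[]/eqP->.
  + by apply: line_cayley_ratioW => //; exact: cayley_ratio1.
  + by apply: line_cayley_ratioN1 => //; left.
  + by apply: line_cayley_ratioW; [| lra | exact: cayley_ratio_prime].
  + by apply: line_cayley_ratioW => //; exact: cayley_ratio_prime_pow0.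
- apply: line_eigenvalue_mem => // b /(prime_pow_eigenvalue_inv p_pr)[c -> cE].
  by exists c => //; move: cE; rewrite !inE => /or3P[]->; rewrite ?orbT.
Qed.

Lemma num_distinct_line_double_prime p :
  prime p -> (2 < p)%N ->
  num_distinct_eigenvalues
    (adjacency_matrix C (line_graph (unitary_cayley (2 * p)))) 4.
Proof.
move=> p_pr p_gt2.
have /andP[x0 x1] : 0 < (p.-1%:R^-1 : rat) < 1 by apply: inv_nat_lt1; lia.
apply: (@num_distinct_line C _ [:: 1; -1; p.-1%:R^-1; - p.-1%:R^-1]).
- by lia.
- by rewrite /= !inE !negb_or !andbT; apply/and3P; split; rewrite ?andbT; lra.
- by apply: line_cayley_ratio_even => //; [lia | exact: dvdn_mulr | exact: dvdn_mull].
- by apply: line_eigenvalue_mem => [||b /double_prime_eigenvalue_inv]; [lia| |exact].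
Qed.

(** At most three values remain: for [e = 0] there is no ratio 0, and for [p = 2] the ratio -1/(p-1)
    coincides with -1. *)
Lemma num_distinct_line_prime_or_pow2 p e :
  prime p -> e = 0%N \/ p = 2 ->
  ~ num_distinct_eigenvalues
    (adjacency_matrix C (line_graph (unitary_cayley (p ^ e.+1)))) 4.
Proof.
move=> p_pr pe; have n_gt1 : (1 < p ^ e.+1)%N.
  by rewrite -(expn0 p) ltn_exp2l // prime_gt1.
suff [cs [sz csN1 cs_all]] : exists cs : seq rat, [/\ size cs = 3, -1 \in cs &
    forall b : C, graph_eigenvalue (unitary_cayley (p ^ e.+1)) b ->
      exists2 c, b = ratr c * (totient (p ^ e.+1))%:R & c \in cs].
  move=> /(num_distinct_line_le (line_eigenvalue_mem n_gt1 csN1 cs_all)).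
  by rewrite sz.
case: pe => [->|p2].
  exists [:: 1; -1; - p.-1%:R^-1]; split => // b; rewrite expn1.
  move=> /(prime_eigenvalue_inv p_pr)[c -> cE]; exists c => //.
  by move: cE; rewrite !inE => /orP[]->; rewrite ?orbT.
exists [:: 1; -1; 0]; split => // b /(prime_pow_eigenvalue_inv p_pr)[c -> cE].
by exists c => //; move: cE; rewrite p2 /= invr1.
Qed.

Lemma num_distinct_line_odd_primes p q n :
  prime p -> prime q -> (2 < p)%N -> (2 < q)%N -> p != q -> (0 < n)%N ->
  (p %| n)%N -> (q %| n)%N ->
  ~ num_distinct_eigenvalues
    (adjacency_matrix C (line_graph (unitary_cayley n))) 4.
Proof.
move=> p_pr q_pr p_gt2 q_gt2 pq n_gt0 pn qn.
have := line_cayley_ratio_odd_primes p_pr q_pr p_gt2 q_gt2 pq n_gt0 pn qn.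
have /andP[x0 x1] : 0 < (p.-1%:R^-1 : rat) < 1 by apply: inv_nat_lt1; lia.
have /andP[y0 y1] : 0 < (q.-1%:R^-1 : rat) < 1 by apply: inv_nat_lt1; lia.
have xy : p.-1%:R^-1 != q.-1%:R^-1 :> rat.
  by rewrite (inj_eq invr_inj) eqr_nat; lia.
suff cs_uniq : uniq [:: 1; -1; - p.-1%:R^-1; - q.-1%:R^-1;
    p.-1%:R^-1 * q.-1%:R^-1 : rat].
  by move=> cs_eig /(num_distinct_line_ge n_gt0 cs_uniq cs_eig).
(* Only the bounds between 0 and 1 and [x != y] matter from here; abstracting the product as [z]
   leaves linear goals. *)
move: (p.-1%:R^-1) (q.-1%:R^-1) x0 x1 y0 y1 xy => x y x0 x1 y0 y1 xy.
have xy0 : 0 < x * y by rewrite mulr_gt0.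
have xy1 : x * y < 1 by nra.
move: (x * y) xy0 xy1 => z z0 z1.
by rewrite /= !inE !negb_or (eqr_opp x) xy; repeat (apply/andP; split); lra.
Qed.

(** Let q be the least prime factor of n/(2p). Either q is an odd prime other than [p], or q is 2 or
    [p] and q^2 divides n, so that 0 is a fifth ratio. *)
Lemma num_distinct_line_even p n :
  prime p -> (2 < p)%N -> (0 < n)%N -> (2 * p %| n)%N -> n != (2 * p)%N ->
  ~ num_distinct_eigenvalues
    (adjacency_matrix C (line_graph (unitary_cayley n))) 4.
Proof.
move=> p_pr p_gt2 n_gt0 /dvdnP[m nE] n2p.
have pn : (p %| n)%N by rewrite nE mulnA dvdn_mull.
have n2 : (2 %| n)%N by rewrite nE mulnCA dvdn_mulr.
have m_gt1 : (1 < m)%N.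
  by move: n_gt0 n2p; rewrite nE; case: m nE => [|[|]] //; rewrite mul1n eqxx.
have q_pr := pdiv_prime m_gt1; set q := pdiv m in q_pr.
have qm : (q %| m)%N by exact: pdiv_dvd.
have qn : (q %| n)%N by rewrite nE dvdn_mulr.
have n_gt1 : (1 < n)%N by have := dvdn_leq n_gt0 pn; lia.
have [/andP[q_gt2 pq]|qE] := boolP ((2 < q)%N && (p != q)).
  exact: num_distinct_line_odd_primes pn qn.
have q2n : (q ^ 2 %| n)%N.
  rewrite nE expnS expn1 dvdn_mul //; move: qE; rewrite negb_and negbK -leqNgt.
  have := prime_gt1 q_pr; rewrite ltn_neqAle leq_eqVlt.
  move=> q_gt1 /orP[q_le2|/eqP<-]; last exact: dvdn_mull.
  have -> : q = 2 by lia.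
  exact: dvdn_mulr.
have cs_eig := line_cayley_ratio_even p_pr p_gt2 n_gt0 n2 pn.
have cs0_eig : {in [:: 0; 1; -1; p.-1%:R^-1; - p.-1%:R^-1],
    forall c, line_cayley_ratio C n c}.
  move=> c; rewrite in_cons => /orP[/eqP->|/cs_eig //].
  by apply: line_cayley_ratioW => //; exact: cayley_ratio_square q2n.
have /andP[x0 x1] : 0 < (p.-1%:R^-1 : rat) < 1 by apply: inv_nat_lt1; lia.
suff cs_uniq : uniq [:: 0; 1; -1; p.-1%:R^-1; - p.-1%:R^-1 : rat].
  by move=> /(num_distinct_line_ge n_gt0 cs_uniq cs0_eig).
move: (p.-1%:R^-1 : rat) x0 x1 => x x0 x1; clear -x0 x1.
by rewrite /= !inE !negb_or; repeat (apply/andP; split); lra.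
Qed.

End FourEigenvalues.

(* The classification of n *)
Local Close Scope ring_scope.

Theorem theorem4p9 (C : numClosedFieldType) (n : nat) (n_gt0 : 0 < n) :
  num_distinct_eigenvalues
    (adjacency_matrix C (line_graph (unitary_cayley n))) 4
  <->
  (exists p : nat,
    [/\ prime p, 3 <= p &
      n = 2 * p \/ (exists alpha : nat, 2 <= alpha /\ n = p ^ alpha)]).
Proof.
split; last first.
  move=> [p [p_pr p_gt2 [->|[[|[|e]] [//= _ ->]]]]].
    exact: num_distinct_line_double_prime.
  exact: num_distinct_line_prime_pow.
move=> n4; have n_gt1 : (1 < n)%N.
  (* For n = 1 the line graph has no vertex, since an edge needs two distinct endpoints, so there is
     no eigenvalue at all. *)
  rewrite ltn_neqAle n_gt0 andbT; apply: contraPneq n4 => n1.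
  move=> [s [_ s4 sE]]; case: s s4 sE => // a s _ /(_ a).
  rewrite mem_head => /esym.
  move=> /eigenvalue_line_matrixP[h [e _] _].
  have [x [y [/eqP xy _ _]]] := edgeP e; case: xy; apply: val_inj.
  by move: (ltn_ord x) (ltn_ord y) n1 => /=; lia.
have p_pr := pdiv_prime n_gt1; set p := pdiv n in p_pr.
have pn : (p %| n)%N by exact: pdiv_dvd.
have [e [m [m_gt0 cop nE]]] := prime_part p_pr n_gt0 pn.
(* If n is a power of its least prime [p], the cases [p = 2] and exponent 1 have too few
   eigenvalues. *)
have [m1|m_neq1] := eqVneq m 1%N.
  rewrite m1 muln1 in nE; rewrite nE in n4.
  exists p; split=> //.
    rewrite ltn_neqAle prime_gt1 // andbT; apply: contraPneq n4 => p2.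
    by apply: num_distinct_line_prime_or_pow2 => //; right.
  right; exists e.+1; split => //; case: e {cop nE} n4 => // n4.
  by case: (num_distinct_line_prime_or_pow2 p_pr (or_introl erefl) n4).
have m_gt1 : (1 < m)%N by rewrite ltn_neqAle eq_sym m_neq1.
have q_pr := pdiv_prime m_gt1; set q := pdiv m in q_pr.
have qn : (q %| n)%N by rewrite nE dvdn_mull // pdiv_dvd.
have pq : p != q.
  apply: contraTneq cop => pq; rewrite coprime_pexpl // prime_coprime // negbK.
  by rewrite pq pdiv_dvd.
(* Minimality of [p] and [p != q] make [q] odd; then [p] odd would give two odd prime factors, so
   [p = 2] and [2 * q] divides n. *)
have p_le_q : (p <= q)%N by apply: pdiv_min_dvd => //; exact: prime_gt1.
have q_gt2 : (2 < q)%N by have := prime_gt1 p_pr; lia.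
have [p2|p_neq2] := eqVneq p 2; last first.
  have p_gt2 : (2 < p)%N by rewrite ltn_neqAle eq_sym p_neq2 prime_gt1.
  by case: (num_distinct_line_odd_primes p_pr q_pr p_gt2 q_gt2 pq n_gt0 pn qn n4).
have cop2 : coprime 2 q by rewrite prime_coprime // dvdn_prime2 // ltn_eqF.
have n2 : (2 %| n)%N by move: pn; rewrite p2.
exists q; split => //; left; apply/eqP; apply: contraPT n4.
by apply: num_distinct_line_even => //; rewrite Gauss_dvd // n2 qn.
Qed.
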